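(* For every positive integer $m$ there exist explicitly computable constants $d>0$, $e_1$, $e_2$, depending only on $m$, such that the following holds. Let $k,n$ be positive integers with $k>2m(m+1)-1$ and $n>(m+1)k+d$, and let $u$ be the natural number whose binary expansion is \[ (u)_2=1^{(k)}\,0\,1^{(k+1)}\,0\,1^{(k+2)}\,0\cdots 0\,1^{(k+m)}\,0\,1^{(n)}. \] Then $s_2(u^2)=n-mk+e_1$ and $s_2(u)=n+k(m+1)+e_2$.
   Context: $s_2(n)$ denotes the sum of the binary digits of $n$. In a digit string, $x^{(a)}$ denotes the digit $x$ repeated $a$ times consecutively; the string is read from the most significant digit to the least significant. Thus $(u)_2$ consists of a block of $k$ ones, a zero, a block of $k+1$ ones, a zero, and so on up to a block of $k+m$ ones, a zero, and finally a block of $n$ ones. *)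

(* Defs.v *)
From mathcomp Require Export all_boot all_order all_algebra.

Set Implicit Arguments.
Unset Strict Implicit.
Unset Printing Implicit Defensive.

Definition binary_digit (n i : nat) : nat := (n %/ 2 ^ i) %% 2.

(* The digits at positions i >= n vanish since n < 2 ^ n, so the sum over
   i < n runs over all the nonzero digits. *)
Definition s2 (n : nat) : nat := \sum_(i < n) binary_digit n i.

(* Digit strings are listed from the most significant digit to the least
   significant one. *)
Definition binary_value (ds : seq nat) : nat :=
  foldl (fun a d => 2 * a + d) 0 ds.

Definition u_digits (m k n : nat) : seq nat :=
  flatten [seq rcons (nseq (k + i) 1) 0 | i <- iota 0 m.+1] ++ nseq n 1.

(* The total recursive functions nat ^ p -> nat: the closure of the basic
   functions under composition, primitive recursion and minimization, where
   minimization is applied only when the minimum always exists. Each operation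
   is given by its defining equations, hence the closure under pointwise
   equality. *)
Inductive recursive : forall p : nat, (p.-tuple nat -> nat) -> Prop :=
| recursive_zero : recursive (fun _ : 0.-tuple nat => 0)
| recursive_succ : recursive (fun v : 1.-tuple nat => (thead v).+1)
| recursive_proj (p : nat) (i : 'I_p) :
    recursive (fun v : p.-tuple nat => tnth v i)
| recursive_comp (p q : nat) (f : q.-tuple nat -> nat)
    (g : 'I_q -> p.-tuple nat -> nat) (h : p.-tuple nat -> nat) :
    recursive f -> (forall i, recursive (g i)) ->
    (forall v, h v = f [tuple g i v | i < q]) ->
    recursive h
| recursive_primrec (p : nat) (f : p.-tuple nat -> nat)
    (g : p.+2.-tuple nat -> nat) (h : p.+1.-tuple nat -> nat) :
    recursive f -> recursive g ->
    (forall v : p.-tuple nat, h [tuple of 0 :: v] = f v) ->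
    (forall (x : nat) (v : p.-tuple nat),
      h [tuple of x.+1 :: v] = g [tuple of x :: h [tuple of x :: v] :: v]) ->
    recursive h
| recursive_min (p : nat) (f : p.+1.-tuple nat -> nat)
    (h : p.-tuple nat -> nat) :
    recursive f ->
    (forall v : p.-tuple nat, f [tuple of h v :: v] = 0) ->
    (forall (v : p.-tuple nat) (x : nat),
      x < h v -> f [tuple of x :: v] <> 0) ->
    recursive h.

Definition computable (f : nat -> nat) : Prop :=
  recursive (fun v : 1.-tuple nat => f (thead v)).

(* An integer is encoded by a pair of natural numbers with that difference. *)
Definition computable_int (f : nat -> int) : Prop :=
  exists a b : nat -> nat,
    [/\ computable a, computable b
      & forall m, f m = ((a m)%:Z - (b m)%:Z)%R].

(* Main.v *)
(* Let B - 1 be the number written by the blocks above 1^(n), so that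
   u + 1 = 2^n B. From u^2 = 1 + 2^(n+1) ((2^(n-1) - B) + 2^(n-1) (B^2 - 1))
   and s_2(2^(n-1) - B) = n - 1 - s_2(B - 1), everything reduces to s_2(B^2).
   With w_0 < ... < w_m the positions of the zeros in B - 1 and W its length,
   B = 2^W - sum_j 2^(w_j). In B^2 the positive terms 2^(w_i + w_j) are grouped
   along the diagonals i + j = s; since k is large the diagonals occupy disjoint
   ranges of digits, and the digit sum of each depends only on s and m, also
   after subtracting the term 2^(w_j + W + 1) that falls in its range. Only the
   difference 2^(2W) - 2^(w_m + W + 1), a run of k ones, depends on k. *)

Require Import Defs.
From mathcomp Require Import all_boot all_order all_algebra.
From mathcomp Require Import zify.

Set Implicit Arguments.
Unset Strict Implicit.
Unset Printing Implicit Defensive.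

(** * Binary digit sums *)

Lemma s2_widen n N : n < 2 ^ N -> s2 n = \sum_(i < N) binary_digit n i.
Proof.
have big0 p q : n < 2 ^ p -> p <= q ->
    \sum_(i < q) binary_digit n i = \sum_(i < p) binary_digit n i.
  move=> lt_np le_pq; rewrite -!(big_mkord xpredT) (@big_cat_nat _ _ _ p) //=.
  rewrite [X in _ + X]big_nat [X in _ + X]big1 ?addn0 // => i /andP[le_pi _].
  rewrite /binary_digit divn_small ?mod0n //.
  by apply: leq_trans lt_np _; rewrite leq_exp2l.
move=> lt_nN; rewrite /s2; case: (leqP n N) => [le_nN|/ltnW le_Nn].
  by rewrite (big0 n N) // ltn_expl.
exact: big0.
Qed.

Lemma s2_bit n (b : bool) : s2 (b + n.*2) = b + s2 n.
Proof.
rewrite (@s2_widen _ n.+1); last first.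
  have : n < 2 ^ n by rewrite ltn_expl.
  rewrite expnS; case: b => /=; lia.
rewrite big_ord_recl; congr (_ + _).
  by rewrite /binary_digit expn0 divn1 modn2 oddD odd_double addbF oddb.
apply: eq_bigr => i _; rewrite /binary_digit lift0 expnS divnMA.
by rewrite divn2 half_bit_double.
Qed.

Lemma s2_0 : s2 0 = 0.
Proof. by rewrite /s2 big_ord0. Qed.

Lemma s2_add_mul e a b : a < 2 ^ e -> s2 (a + 2 ^ e * b) = s2 a + s2 b.
Proof.
elim: e a => [|e IHe] a lt_a.
  by case: a lt_a => // _; rewrite s2_0 mul1n.
have Ea := odd_double_half a.
have -> : a + 2 ^ e.+1 * b = odd a + (a./2 + 2 ^ e * b).*2.
  rewrite expnS; lia.
rewrite s2_bit IHe ?addnA -?s2_bit ?Ea //.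
move: lt_a; rewrite expnS; lia.
Qed.

Lemma s2_mul_exp2 e b : s2 (2 ^ e * b) = s2 b.
Proof. by rewrite -[2 ^ e * b]add0n s2_add_mul ?expn_gt0 // s2_0. Qed.

(** Subtraction from [e] ones involves no borrow: it flips each of the [e] digits. *)
Lemma s2_complement e a : a < 2 ^ e -> s2 (2 ^ e - 1 - a) + s2 a = e.
Proof.
elim: e a => [|e IHe] a lt_a; first by case: a lt_a; rewrite // s2_0.
have Ea := odd_double_half a.
have -> : 2 ^ e.+1 - 1 - a = ~~ odd a + (2 ^ e - 1 - a./2).*2.
  move: lt_a; rewrite expnS; case: (odd a) Ea => /=; lia.
have lt_a2 : a./2 < 2 ^ e by move: lt_a; rewrite expnS; lia.
have Es : s2 a = odd a + s2 a./2 by rewrite -s2_bit Ea.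
by rewrite s2_bit Es addnACA IHe //; case: (odd a).
Qed.

Lemma s2_exp2_pred e : s2 (2 ^ e - 1) = e.
Proof.
by have := @s2_complement e 0; rewrite s2_0 subn0 addn0 expn_gt0; apply.
Qed.

Lemma s2_1 : s2 1 = 1.
Proof. exact: (s2_exp2_pred 1). Qed.

Lemma s2_mul_pred e x : 0 < x -> s2 (2 ^ e * x - 1) = s2 (x - 1) + e.
Proof.
move=> x_gt0; have e_gt0 : 0 < 2 ^ e by rewrite expn_gt0.
have -> : 2 ^ e * x - 1 = (2 ^ e - 1) + 2 ^ e * (x - 1) by nia.
by rewrite s2_add_mul ?s2_exp2_pred 1?addnC //; lia.
Qed.

Lemma s2_odd_pred x : odd x -> s2 x = (s2 (x - 1)).+1.
Proof.
move=> odd_x; have Ex := odd_double_half x; rewrite odd_x in Ex.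
by rewrite -Ex addKn (s2_bit _ true) (s2_bit _ false).
Qed.

(** Each [x i] fits in the digits from [e i] up to [e i.+1], so no carry occurs. The size bound lets
    the result serve as [y] in a further application. *)
Lemma s2_cat_blocks (e x : nat -> nat) n y :
    y < 2 ^ e 0 ->
    (forall i, i < n -> e i <= e i.+1 /\ x i < 2 ^ (e i.+1 - e i)) ->
  y + \sum_(i < n) 2 ^ e i * x i < 2 ^ e n /\
  s2 (y + \sum_(i < n) 2 ^ e i * x i) = s2 y + \sum_(i < n) s2 (x i).
Proof.
move=> lt_y; elim: n => [|n IHn] Hx; first by rewrite !big_ord0 !addn0.
have [lt_s Es] := IHn (fun i lt_in => Hx i (ltnW lt_in)).
have [le_e lt_x] := Hx n (ltnSn n).
rewrite !big_ord_recr /= !addnA; split; last by rewrite s2_add_mul // Es.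
move: lt_s lt_x; rewrite -{2}(subnK le_e) expnD.
set s := y + _; set E := 2 ^ e n; set D := 2 ^ _; nia.
Qed.

(** * Digit sums of the diagonals *)

(* Up to a power of 2, a diagonal i + j = s of the square of the sum of the
   2 ^ w_j; there w_i + w_j is concave in i, whence the exponents a (M - a). *)
Definition central (M : nat) : nat := \sum_(a < M.+1) 2 ^ (a * (M - a)).

(** The end terms give 2; inside, [(a + 1) * (M + 1 - a) = a * (M - a) + M + 1]. *)
Lemma centralSS M : central M.+2 = 2 + 2 ^ M.+1 * central M.
Proof.
rewrite /central big_ord_recl big_ord_recr /= mul0n /bump leq0n add1n.
rewrite subnn muln0 addn1 -add2n.
congr (_ + _); rewrite big_distrr; apply: eq_bigr => -[a lt_a] _ /=.
rewrite -expnD; congr (2 ^ _); nia.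
Qed.

Lemma central_gt0 M : 0 < central M.
Proof. by rewrite /central big_ord_recl /= mul0n. Qed.

Lemma central_lt M : central M < 2 ^ (M * M + M).+1.
Proof.
have le_c : central M <= M.+1 * 2 ^ (M * M).
  rewrite /central -[M.+1 in X in _ <= X]card_ord -sum_nat_const.
  by apply: leq_sum => -[a lt_a] _ /=; rewrite leq_exp2l //; nia.
apply: leq_ltn_trans le_c _; rewrite -addnS expnD mulnC ltn_pmul2l ?expn_gt0 //.
exact: ltn_expl.
Qed.

Lemma central0 : central 0 = 1.
Proof. by rewrite /central big_ord1. Qed.

Lemma central1 : central 1 = 2.
Proof. by rewrite /central big_ord_recr big_ord1. Qed.

Lemma s2_central M : s2 (central M.+1) = uphalf M.+1.
Proof.
elim/ltn_ind: M => -[|[|M]] IHM.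
- by rewrite central1 -[2]/(2 ^ 1 * 1) s2_mul_exp2 s2_1.
- by rewrite centralSS central0 -[LHS]/(s2 (2 ^ 2 * 1)) s2_mul_exp2 s2_1.
rewrite centralSS s2_add_mul; last by rewrite -[2 in X in X < _]expn1 ltn_exp2l.
by rewrite IHM // -[2]/(2 ^ 1 * 1) s2_mul_exp2 s2_1.
Qed.

Lemma s2_central_predSS M : s2 (central M.+2 - 1) = (s2 (central M)).+1.
Proof.
rewrite centralSS addnC -addnBA // addnC s2_add_mul ?s2_1 //.
by rewrite (@ltn_exp2l 2 0).
Qed.

(** The exception at [M = 2] comes from [central 0 = 1], whose digit sum is 1, while
    [uphalf 0 = 0]. *)
Lemma s2_central_step M :
  s2 (central M.+1) + s2 (central M - 1) = M.+1 + (M == 2).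
Proof.
case: M => [|[|[|M]]]; rewrite s2_central.
- by rewrite central0 s2_0.
- by rewrite central1 s2_1.
- by rewrite s2_central_predSS central0 s2_1.
by rewrite s2_central_predSS s2_central; lia.
Qed.

(** Passing from [m] to [m.+1] adds the pair of [s2_central_step] and the [m] trailing ones of
    [2 ^ m * central m - 1]. *)
Lemma s2_central_sum m :
  \sum_(s < m.+1) s2 (central s) + \sum_(M < m) s2 (2 ^ M * central M - 1)
  = 1 + \sum_(i < m) (i.*2.+1 + (i == 2 :> nat)).
Proof.
elim: m => [|m IHm].
  by rewrite big_ord_recr !big_ord0 /= central0 s2_1.
rewrite big_ord_recr [X in _ + X]big_ord_recr [X in _ = _ + X]big_ord_recr /=.
rewrite addnACA IHm s2_mul_pred ?central_gt0 //.
have := s2_central_step m; rewrite -addnn.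
set S := \sum_(i < m) _; set a := s2 _; set b := s2 _; lia.
Qed.

(** * Computability of the constants *)

Lemma computable_comp f g : computable f -> computable g -> computable (f \o g).
Proof.
move=> rec_f rec_g.
apply: (recursive_comp rec_f (fun _ : 'I_1 => rec_g)) => v.
by rewrite /thead tnth_mktuple.
Qed.

Lemma computable_succ : computable succn.
Proof. exact: recursive_succ. Qed.

Lemma recursive_const p c : recursive (fun _ : p.-tuple nat => c).
Proof.
elim: c => [|c IHc].
  by apply: (recursive_comp recursive_zero (g := fun _ _ => 0)) => // -[].
apply: (recursive_comp recursive_succ (fun _ : 'I_1 => IHc)) => v.
by rewrite /thead tnth_mktuple.
Qed.

Lemma recursive_addn : recursive (fun v : 2.-tuple nat => tnth v ord0 + tnth v (inord 1)).
Proof.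
pose p3 : 3.-tuple nat -> nat := fun v => tnth v (inord 1).
apply: (recursive_primrec (f := fun v : 1.-tuple nat => tnth v ord0) (g := fun v => (p3 v).+1)).
- exact: recursive_proj.
- apply: (recursive_comp recursive_succ (fun _ : 'I_1 => recursive_proj (inord 1 : 'I_3))) => v.
  by rewrite /thead tnth_mktuple.
- by move=> v; rewrite !(tnth_nth 0) /= inordK.
by move=> x v; rewrite /p3 !(tnth_nth 0) /= !inordK.
Qed.

Lemma computable_primrec c (g : nat -> nat -> nat) f :
    recursive (fun v : 2.-tuple nat => g (tnth v ord0) (tnth v (inord 1))) ->
  f 0 = c -> (forall x, f x.+1 = g x (f x)) -> computable f.
Proof.
move=> rec_g f0 fS; apply: (recursive_primrec (recursive_const 0 c) rec_g) => [v|x v].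
  by rewrite theadE.
by rewrite !theadE fS !(tnth_nth 0) /= inordK.
Qed.

Lemma computable_shift f : computable (fun x => f x.+1) -> computable f.
Proof.
move=> rec_f; apply: (@computable_primrec (f 0) (fun x _ => f x.+1)) => //.
apply: (recursive_comp rec_f (fun _ : 'I_1 => recursive_proj ord0)) => v.
by rewrite /thead tnth_mktuple.
Qed.

Lemma computable_sum g : computable g -> computable (fun n => \sum_(i < n) g i).
Proof.
move=> rec_g; apply: (@computable_primrec 0 (fun x y => y + g x)); last 2 first.
- by rewrite big_ord0.
- by move=> x; rewrite big_ord_recr.
pose h (i : 'I_2) (v : 2.-tuple nat) :=
  if val i == 0 then tnth v (inord 1) else g (tnth v ord0).
apply: (recursive_comp recursive_addn (g := h)) => [i|v].
  case: i => -[|[|//]] lt_i; rewrite /h /=; first exact: recursive_proj.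
  apply: (recursive_comp rec_g (fun _ : 'I_1 => recursive_proj ord0)) => v.
  by rewrite /thead tnth_mktuple.
by rewrite !tnth_mktuple /h /= inordK.
Qed.

Lemma eq_computable f g : f =1 g -> computable f -> computable g.
Proof.
move=> eq_fg rec_f.
apply: (recursive_comp rec_f (fun _ : 'I_1 => recursive_proj ord0)) => v.
by rewrite -eq_fg /thead tnth_mktuple.
Qed.

Lemma computable_add_eq2 : computable (fun i => i + (i == 2)).
Proof.
(* Three shifts pass the exceptional index 2, leaving [i + 3]. *)
do 3 apply: computable_shift.
apply: (@eq_computable (succn \o (succn \o succn))) => [i /=|]; first by rewrite addn0.
by do 2 apply: computable_comp computable_succ _; exact: computable_succ.
Qed.

(** * Positions of the zeros *)

(* The positions w_0 = 0 < w_1 < ... < w_(r - 1) of the zeros in the string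
   1^(k) 0 1^(k+1) 0 ... 1^(k+r-1) 0, and its length w_r. *)
Definition gap_pos (k r j : nat) : nat := \sum_(i < j) (k + (r - i)).

Lemma gap_pos0 k r : gap_pos k r 0 = 0.
Proof. exact: big_ord0. Qed.

Lemma gap_posS k r j : gap_pos k r j.+1 = gap_pos k r j + (k + (r - j)).
Proof. exact: big_ord_recr. Qed.

Lemma gap_posSS k r j : gap_pos k r.+1 j.+1 = k + r.+1 + gap_pos k r j.
Proof. by rewrite /gap_pos big_ord_recl subn0. Qed.

(** Consecutive gaps shrink by one, so [gap_pos] has second difference -1; an [a] by [b] rectangle
    of these accounts for [a * b]. *)
Lemma gap_pos_add k r p a b : p + a + b <= r ->
  gap_pos k r (p + a) + gap_pos k r (p + b) =
  gap_pos k r p + gap_pos k r (p + a + b) + a * b.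
Proof.
elim: b => [|b IHb] le_r; first by rewrite !addn0 muln0 addn0 addnC.
rewrite !addnS !gap_posS mulnS.
have := IHb; rewrite addnS in le_r => /(_ (ltnW le_r)); lia.
Qed.

Lemma gap_pos_diag k r : gap_pos k r r = r * k + \sum_(i < r) i.+1.
Proof.
elim: r => [|r IHr]; first by rewrite gap_pos0 big_ord0.
rewrite gap_posSS IHr big_ord_recr /=; lia.
Qed.

(** * Summation along diagonals *)

(** The diagonals beyond [i + j = m] are indexed from the corner [(m, m)]. *)
Lemma sum_square_diagonals (F : nat -> nat -> nat) m :
  \sum_(i < m.+1) \sum_(j < m.+1) F i j =
    \sum_(s < m.+1) \sum_(a < s.+1) F a (s - a) +
    \sum_(s < m) \sum_(a < s.+1) F (m - a) (m - (s - a)).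
Proof.
have triangle n (G : nat -> nat -> nat) :
    \sum_(s < n) \sum_(a < s.+1) G a (s - a) = \sum_(i < n) \sum_(j < n - i) G i j.
  elim: n => [|n IHn]; first by rewrite !big_ord0.
  rewrite big_ord_recr /= IHn [RHS]big_ord_recr /= subSnn big_ord1.
  rewrite big_ord_recr /= subnn addnA; congr (_ + _).
  rewrite -big_split; apply: eq_bigr => -[i lt_in] _ /=.
  by rewrite subSn ?(ltnW lt_in) // big_ord_recr.
rewrite triangle (triangle m (fun a b => F (m - a) (m - b))).
(* Row [i] is cut at column [m.+1 - i]; its last [i] entries are read backwards. *)
transitivity (\sum_(i < m.+1) \sum_(j < m.+1 - i) F i j +
              \sum_(i < m.+1) \sum_(j < i) F i (m - j)).
  rewrite -big_split; apply: eq_bigr => -[i lt_im] _ /=.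
  rewrite -(big_mkord xpredT) (@big_cat_nat _ _ _ (m.+1 - i)) ?leq_subr //=.
  rewrite big_mkord; congr (_ + _).
  rewrite -(big_mkord xpredT (fun j => F i (m - j))) big_nat_rev.
  rewrite -{1}[m.+1 - i]add0n big_addn subKn ?(ltnW lt_im) // ![in RHS]big_nat [LHS]big_nat.
  apply: eq_bigr => j lt_ji; congr (F _ _); lia.
congr (_ + _); rewrite big_ord_recl big_ord0 add0n.
rewrite -(big_mkord xpredT (fun i => \sum_(j < i.+1) F i.+1 (m - j))) big_nat_rev.
rewrite big_mkord; apply: eq_bigr => -[i lt_im] _ /=.
rewrite add0n; have -> : (m - i.+1).+1 = m - i by lia.
by [].
Qed.

(** * The number written by the blocks *)

(* One more than the number written 1^(k) 0 1^(k+1) 0 ... 1^(k+r-1) 0. *)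
Fixpoint ublocks (k r : nat) : nat :=
  if r is r'.+1 then 2 ^ (k + r) * ublocks k r' - 1 else 1.

Lemma ublocks_gt0 k r : 0 < ublocks k r.
Proof.
elim: r => //= r IHr; have : 1 < 2 ^ (k + r.+1) by rewrite (@ltn_exp2l 2 0) // addnS.
by rewrite subn_gt0 => gt1; apply: leq_trans gt1 _; rewrite leq_pmulr.
Qed.

(** Appending a block shifts all positions by its length [k + r.+1], and the subtracted 1 is the new
    zero at position 0. *)
Lemma ublocks_sum k r :
  ublocks k r + \sum_(j < r) 2 ^ gap_pos k r j = 2 ^ gap_pos k r r.
Proof.
elim: r => [|r IHr]; first by rewrite big_ord0 gap_pos0.
rewrite gap_posSS expnD -IHr mulnDr big_ord_recl gap_pos0 big_distrr /= addnA.
rewrite subnK ?muln_gt0 ?expn_gt0 ?ublocks_gt0 //; congr (_ + _).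
by apply: eq_bigr => i _; rewrite -expnD -gap_posSS.
Qed.

Lemma s2_ublocks_pred k r : s2 (ublocks k r - 1) = \sum_(i < r) (k + i).
Proof.
elim: r => [|r IHr]; first by rewrite big_ord0 s2_0.
rewrite big_ord_recr /= -IHr addnS expnS -mulnA.
have x_gt0 : 0 < 2 ^ (k + r) * ublocks k r by rewrite muln_gt0 expn_gt0 ublocks_gt0.
rewrite -s2_mul_pred ?ublocks_gt0 // -[RHS](s2_mul_exp2 1).
congr s2; rewrite expn1; move: x_gt0; set x := _ * _; lia.
Qed.

Lemma odd_ublocks k r : odd (ublocks k r).
Proof.
case: r => //= r; rewrite oddB ?muln_gt0 ?expn_gt0 ?ublocks_gt0 //.
by rewrite oddM oddX /= addnS.
Qed.

(** For the value plus one, appending ones is multiplication by a power of 2; hence the offset in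
    [ublocks]. *)
Lemma foldl_ones n a :
  foldl (fun a d => 2 * a + d) a (nseq n 1) = 2 ^ n * a.+1 - 1.
Proof.
elim: n a => [|n IHn] a /=; first by rewrite mul1n subn1.
rewrite IHn expnS; congr (_ - 1); nia.
Qed.

Lemma binary_value_u_digits m k n :
  binary_value (u_digits m k n) = 2 ^ n * ublocks k m.+1 - 1.
Proof.
rewrite /binary_value /u_digits foldl_cat foldl_ones; congr (_ * _ - 1).
have predK r : (ublocks k r - 1).+1 = ublocks k r.
  by rewrite subn1 prednK ?ublocks_gt0.
have digits r : foldl (fun a d => 2 * a + d) 0
    (flatten [seq rcons (nseq (k + i) 1) 0 | i <- iota 0 r]) = ublocks k r - 1.
  elim: r => [|r IHr]; first by [].
  have -> : iota 0 r.+1 = iota 0 r ++ [:: r] by rewrite -addn1 iotaD.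
  rewrite map_cat flatten_cat foldl_cat IHr /= cats0 -cats1 foldl_cat /= foldl_ones.
  rewrite predK addnS expnS -mulnA; lia.
by rewrite digits predK.
Qed.

(** * Digit sum of the square of the blocks *)

(** By [gap_pos_add] the exponents on a diagonal are those of [central] plus a constant. On the far
    diagonals this constant is split to expose the power of 2 that is subtracted there in the square
    of [ublocks]. *)
Lemma sum_gap_pos_square k m :
  (\sum_(j < m.+1) 2 ^ gap_pos k m.+1 j) ^ 2 =
  \sum_(s < m.+1) 2 ^ gap_pos k m.+1 s * central s +
  \sum_(j < m) 2 ^ (gap_pos k m.+1 j + gap_pos k m.+1 m.+1).+1 *
     (2 ^ (m - j.+1) * central (m - j.+1)).
Proof.
set w := gap_pos k m.+1.
rewrite expnS expn1 big_distrlr /= (sum_square_diagonals (fun i j => 2 ^ w i * 2 ^ w j)).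
congr (_ + _).
  apply: eq_bigr => -[s lt_s] _ /=; rewrite big_distrr /=.
  apply: eq_bigr => -[a lt_a] _ /=; rewrite -!expnD; congr (2 ^ _).
  have := @gap_pos_add k m.+1 0 a (s - a); rewrite gap_pos0 !add0n /w => ->; last by lia.
  by congr (gap_pos _ _ _ + _); lia.
rewrite (reindex_inj rev_ord_inj); apply: eq_bigr => -[j lt_j] _ /=.
rewrite big_distrr big_distrr /=; apply: eq_bigr => -[a lt_a] _ /=.
rewrite -!expnD; congr (2 ^ _).
set M := m - j.+1 in lt_a *.
have := @gap_pos_add k m.+1 j.+1 (M - a) a.
have -> : j.+1 + (M - a) = m - a by lia.
have -> : j.+1 + a = m - (M - a) by lia.
have -> : m - a + a = m by lia.
move=> /(_ (leqnSn m)).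
(* This instance trades [w j.+1 + w m] for [w j + w m.+1] at the cost [M.+1]: the factors 2 and
   [2 ^ M]. *)
have := @gap_pos_add k m.+1 j 1 M.+1.
rewrite addn1.
have -> : j + M.+1 = m by lia.
have -> : j.+1 + M.+1 = m.+1 by lia.
move=> /(_ (leqnn _)).
rewrite mul1n -/w; lia.
Qed.

(** The bound on [k] makes every gap wide enough for its diagonal, by [central_lt]. *)
Lemma s2_ublocks_square k m : m * m.+1 <= k ->
  s2 (ublocks k m.+1 ^ 2) = k + (1 + \sum_(i < m) (i.*2.+1 + (i == 2 :> nat))).
Proof.
move=> le_k; pose w := gap_pos k m.+1; pose W := w m.+1.
pose e j := (w j + W).+1; pose x j := 2 ^ (m - j.+1) * central (m - j.+1) - 1.
have x_gt0 M : 0 < 2 ^ M * central M by rewrite muln_gt0 expn_gt0 central_gt0.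
have [|s lt_s|lt_low s2_low] := @s2_cat_blocks w central m.+1 0.
- by rewrite expn_gt0.
- rewrite /w gap_posS leq_addr addKn; split=> //.
  by apply: leq_trans (central_lt s) _; rewrite leq_exp2l //; nia.
set low := _ + _ in lt_low s2_low.
(* [low] lies below [2 ^ W] and [e 0 = W.+1], so the far diagonals start above it. *)
have [||lt_high s2_high] := @s2_cat_blocks e x m low.
- by apply: leq_trans lt_low _; rewrite leq_exp2l // /e leqW // leq_addl.
- move=> j lt_j; rewrite /e /w gap_posS; split; first by lia.
  have -> : forall a b c, (a + b + c).+1 - (a + c).+1 = b by lia.
  rewrite /x; set M := m - j.+1.
  have := central_lt M; rewrite -(@ltn_pmul2l (2 ^ M)) ?expn_gt0 // -expnD => lt_c.
  apply: leq_ltn_trans (leq_subr _ _) (leq_trans lt_c _).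
  rewrite leq_exp2l //; have : M < m by lia.
  nia.
set high := _ + _ in lt_high s2_high.
(* Each subtracted 2 ^ (w j + W).+1 with j < m is absorbed in the block [x j];
   the one with j = m meets 2 ^ (2 * W) and leaves a run of k ones. *)
have -> : ublocks k m.+1 ^ 2 = high + 2 ^ e m * (2 ^ k - 1).
  have := ublocks_sum k m.+1; have := sum_gap_pos_square k m.
  rewrite -/w -/W; set S := \sum_(j < m.+1) 2 ^ w j; set B := ublocks _ _.
  move=> S2 BS.
  (* Squaring [B = 2 ^ W - S] subtracts [2 ^ W.+1 * S], the sum of all [2 ^ e j]; [high] accounts
     for those with [j < m]. *)
  have ES : S ^ 2 + 2 ^ e m = high + 2 ^ W.+1 * S.
    rewrite S2 /high /low add0n -!addnA; congr (_ + _).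
    rewrite /S big_distrr big_ord_recr /= addnA -big_split /=.
    congr (_ + _); last by rewrite -expnD addSn addnC.
    apply: eq_bigr => -[j lt_j] _ /=; rewrite /x /e -/w -expnD addSn addnC.
    by rewrite -mulnSr subn1 prednK.
  (* Since [W = w m + k + 1], [e m + k = 2 * W]. *)
  have EW : 2 ^ e m * 2 ^ k = (2 ^ W) ^ 2.
    rewrite -expnD -expnM /e; congr (2 ^ _); rewrite /W /w gap_posS; lia.
  move: ES EW; rewrite -BS (expnS 2 W) -BS mulnBr muln1 !expnS !expn0.
  have := expn_gt0 2 k; nia.
rewrite s2_add_mul // s2_exp2_pred s2_high s2_low s2_0 add0n.
rewrite -s2_central_sum addnC; congr (_ + (_ + _)).
rewrite (reindex_inj rev_ord_inj); apply: eq_bigr => -[j lt_j] _ /=.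
by rewrite /x /= subnSK // subKn // ltnW.
Qed.

Theorem theorem2p1 :
  exists (d : nat -> nat) (e1 e2 : nat -> int),
    [/\ computable d, computable_int e1, computable_int e2
      & forall m : nat, 0 < m ->
          0 < d m /\
          forall k n : nat, 0 < k -> 0 < n ->
            2 * m * m.+1 - 1 < k ->
            m.+1 * k + d m < n ->
            forall u : nat, u = binary_value (u_digits m k n) ->
              ((s2 (u ^ 2))%:Z = n%:Z - (m * k)%:Z + e1 m)%R /\
              ((s2 u)%:Z = n%:Z + (k * m.+1)%:Z + e2 m)%R].
Proof.
pose T m := \sum_(i < m) i.+1.
pose E m := \sum_(i < m) (i + (i == 2 :> nat)).
have rec_T : computable T := computable_sum computable_succ.
have rec_0 : computable (fun=> 0) := recursive_const 1 0.
(* [T m.+1] is the excess of the total block length over [m.+1 * k]; [E m] is [m(m-1)/2], plus one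
   when [m > 2]. *)
exists (T \o succn), (fun m => (E m)%:Z)%R, (fun m => (T m)%:Z)%R; split.
- exact: computable_comp rec_T computable_succ.
- exists E, (fun=> 0); split=> // [|m]; last by rewrite GRing.subr0.
  exact: computable_sum computable_add_eq2.
- by exists T, (fun=> 0); split=> // m; rewrite GRing.subr0.
move=> m m_gt0; split=> [|k n k_gt0 n_gt0 lt_k lt_n u ->].
  by rewrite /T /= big_ord_recr /= addn_gt0 orbT.
rewrite binary_value_u_digits; set B := ublocks k m.+1.
have B_gt0 : 0 < B := ublocks_gt0 k m.+1.
have s2_B1 : s2 (B - 1) = k * m.+1 + T m.
  rewrite s2_ublocks_pred big_split /= sum_nat_const card_ord mulnC; congr (_ + _).
  by rewrite big_ord_recl.
have s2_B2 : s2 (B ^ 2 - 1) = k + \sum_(i < m) (i.*2.+1 + (i == 2 :> nat)).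
  apply: succn_inj; rewrite -s2_odd_pred; last by rewrite oddX odd_ublocks orbT.
  rewrite s2_ublocks_square; [lia|nia].
have s2_u : s2 (2 ^ n * B - 1) = n + k * m.+1 + T m.
  by rewrite s2_mul_pred // s2_B1; lia.
split; last by rewrite s2_u; lia.
(* Now [n] is one less than the number of final ones; the strict bound on the latter gives
   [B <= 2 ^ n]. *)
case: n n_gt0 lt_n {s2_u} => // n _ lt_n.
have le_B : B <= 2 ^ n.
  apply: (@leq_trans (2 ^ gap_pos k m.+1 m.+1)); first by rewrite -ublocks_sum leq_addr.
  by rewrite leq_exp2l // gap_pos_diag.
have -> : (2 ^ n.+1 * B - 1) ^ 2 =
    1 + 2 ^ n.+2 * ((2 ^ n - 1 - (B - 1)) + 2 ^ n * (B ^ 2 - 1)).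
  rewrite (expnS 2 n.+1) (expnS 2 n); set N := 2 ^ n in le_B *.
  move: {s2_B1 s2_B2} B B_gt0 le_B => -[|b] // _ le_b.
  have [c ->] : exists c, N = b.+1 + c by exists (N - b.+1); rewrite subnKC.
  have -> : b.+1 + c - 1 - (b.+1 - 1) = c by lia.
  have -> : b.+1 ^ 2 - 1 = b * b + 2 * b by rewrite expnS expn1; lia.
  have square_pred q : 0 < q -> (2 * q - 1) ^ 2 + 4 * q = 4 * (q * q) + 1.
    case: q => // q _; have -> : 2 * q.+1 - 1 = 2 * q + 1 by lia.
    by rewrite expnS expn1; lia.
  have := square_pred ((b.+1 + c) * b.+1); rewrite mulnA muln_gt0 => /(_ isT).
  by lia.
rewrite (s2_add_mul (e := n.+2)) ?s2_1; last by rewrite (@ltn_exp2l 2 0).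
rewrite s2_add_mul; last by lia.
have lt_B1 : B - 1 < 2 ^ n by lia.
have := s2_complement lt_B1; rewrite s2_B1 s2_B2.
have <- : E m + T m = \sum_(i < m) (i.*2.+1 + (i == 2 :> nat)).
  by rewrite -big_split; apply: eq_bigr => i _ /=; lia.
lia.
Qed.
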